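(* Let $n\ge 2$, let $\Omega\subset\mathbb{R}^n$ be open and bounded, let $d={\rm diam}(\Omega)$, let $1<p<\infty$, $f\in\mathcal{C}(\Omega)$ and $u\in\mathcal{C}(\overline\Omega)$. (i) If $-\Delta_p^N u\le f(x)$ in $\Omega$ in the viscosity sense, then $$\big(\sup_{\Omega}u^{+}-\sup_{\partial\Omega}u^{+}\big)^2\le \frac{2\,p\,d^2}{p-1}\int_{\sup_{\partial\Omega}u^{+}}^{\sup_{\Omega}u^{+}}\big\|f^{+}\cdot 1_{C^{+}(u)}\big\|_{L^\infty(\{u^{+}=r\})}\,dr .$$ (ii) If $-\Delta_p^N u\ge f(x)$ in $\Omega$ in the viscosity sense, then $$\big(\sup_{\Omega}u^{-}-\sup_{\partial\Omega}u^{-}\big)^2\le \frac{2\,p\,d^2}{p-1}\int_{\sup_{\partial\Omega}u^{-}}^{\sup_{\Omega}u^{-}}\big\|f^{-}\cdot 1_{C^{+}(-u)}\big\|_{L^\infty(\{u^{-}=r\})}\,dr .$$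
   Context: Notation: $a^+=\max\{0,a\}$, $a^-=\max\{0,-a\}$; $1_A$ is the indicator function of $A$; for a symmetric matrix $X$, $M(X)$ and $m(X)$ are its greatest and smallest eigenvalues. The normalized $p$-Laplacian is, where $\nabla\varphi\ne0$, $\Delta_p^N\varphi=\frac1p|\nabla\varphi|^{2-p}{\rm div}(|\nabla\varphi|^{p-2}\nabla\varphi)=\frac1p\Delta\varphi+\frac{p-2}{p}\big\langle D^2\varphi\frac{\nabla\varphi}{|\nabla\varphi|},\frac{\nabla\varphi}{|\nabla\varphi|}\big\rangle$. Viscosity sense: an upper semicontinuous $u:\Omega\to\mathbb{R}$ satisfies $-\Delta_p^N u\le f$ in $\Omega$ if for all $x_0\in\Omega$ and $\varphi\in\mathcal{C}^2(\Omega)$ such that $u-\varphi$ has a local maximum at $x_0$: $-\Delta_p^N\varphi(x_0)\le f(x_0)$ if $\nabla\varphi(x_0)\neq0$; $-\frac1p\Delta\varphi(x_0)-\frac{p-2}{p}M(D^2\varphi(x_0))\le f(x_0)$ if $\nabla\varphi(x_0)=0$ and $p\ge2$; $-\frac1p\Delta\varphi(x_0)-\frac{p-2}{p}m(D^2\varphi(x_0))\le f(x_0)$ if $\nabla\varphi(x_0)=0$ and $1<p\le2$. A lower semicontinuous $u$ satisfies $-\Delta_p^N u\ge f$ in $\Omega$ if for all $x_0\in\Omega$ and $\varphi\in\mathcal{C}^2(\Omega)$ such that $u-\varphi$ has a local minimum at $x_0$: $-\Delta_p^N\varphi(x_0)\ge f(x_0)$ if $\nabla\varphi(x_0)\neq0$;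 $-\frac1p\Delta\varphi(x_0)-\frac{p-2}{p}m(D^2\varphi(x_0))\ge f(x_0)$ if $\nabla\varphi(x_0)=0$ and $p\ge2$; $-\frac1p\Delta\varphi(x_0)-\frac{p-2}{p}M(D^2\varphi(x_0))\ge f(x_0)$ if $\nabla\varphi(x_0)=0$ and $1<p\le2$. Concave envelope and upper contact set: for $w\in\mathcal{C}(\overline\Omega)$ and $x\in\Omega$, $\Gamma(w)(x)=\inf\{L(x): L \text{ affine},\ L\ge w \text{ in }\Omega\}$ and $C^+(w)=\{x\in\Omega: w(x)=\Gamma(w)(x)\}$. $\|g\|_{L^\infty(\{u^\pm=r\})}$ denotes the (pointwise) supremum of $|g|$ over the level set $\{x\in\Omega:u^\pm(x)=r\}$. The right-hand sides may be $+\infty$. *)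

(* Defs.v *)
From mathcomp Require Import all_boot all_order all_algebra.
From mathcomp Require Import all_classical all_reals all_analysis.

Set Implicit Arguments.
Unset Strict Implicit.
Unset Printing Implicit Defensive.

Import Order.TTheory GRing.Theory Num.Theory.
Import numFieldNormedType.Exports.

Local Open Scope classical_set_scope.
Local Open Scope ring_scope.

Section euclidean.
Context {R : realType} {n : nat}.
Implicit Types (x y : 'rV[R]_n) (W : set 'rV[R]_n).

Definition dotv x y : R := \sum_(i < n) x 0 i * y 0 i.

(* The library norm on 'rV[R]_n is the sup norm; it induces the same topology
   and the same bounded sets, but |grad phi| and the diameter are Euclidean. *)
Definition enorm x : R := Num.sqrt (dotv x x).

Definition ediam W : R := sup [set enorm (z.1 - z.2) | z in W `*` W].

Definition boundary W : set 'rV[R]_n := closure W `\` W°.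

End euclidean.

Section differential_operators.
Context {R : realType} {n : nat}.
Implicit Types (phi : 'rV[R]_n -> R) (x : 'rV[R]_n) (W : set 'rV[R]_n) (p : R).

Definition partial (i : 'I_n) phi : 'rV[R]_n -> R :=
  fun x => 'D_(delta_mx 0 i) phi x.

Definition grad phi x : 'rV[R]_n := \row_i partial i phi x.

Definition hess phi x : 'M[R]_n := \matrix_(i, j) partial i (partial j phi) x.

Definition divergence (F : 'rV[R]_n -> 'rV[R]_n) x : R :=
  \sum_(i < n) partial i (fun y => F y 0 i) x.

Definition laplacian phi x : R := divergence (grad phi) x.

(* Meaningful where grad phi x != 0. *)
Definition plaplN p phi x : R :=
  p^-1 * enorm (grad phi x) `^ (2 - p) *
  divergence (fun y => enorm (grad phi y) `^ (p - 2) *: grad phi y) x.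

(* phi is of class C^2 in the open set W; values of phi off W are irrelevant. *)
Definition C2_on W phi : Prop :=
  [/\ {within W, continuous phi},
      forall i, (forall x, W x -> derivable phi x (delta_mx 0 i)) /\
                {within W, continuous (partial i phi)}
    & forall i j,
        (forall x, W x -> derivable (partial j phi) x (delta_mx 0 i)) /\
        {within W, continuous (partial i (partial j phi))}].

End differential_operators.

Section eigenvalues.
Context {R : realType} {n : nat}.
Implicit Types X : 'M[R]_n.

(* For symmetric X and n > 0, the set of (real) eigenvalues is finite and
   nonempty, so sup and inf are attained. *)
Definition max_eigenvalue X : R := sup [set a | eigenvalue X a].
Definition min_eigenvalue X : R := inf [set a | eigenvalue X a].

End eigenvalues.

Section viscosity.
Context {R : realType} {n : nat}.
Implicit Types (W : set 'rV[R]_n) (u f phi : 'rV[R]_n -> R) (p : R).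

Definition usc_on W u : Prop :=
  forall x, W x -> forall c, u x < c -> \forall y \near x, W y -> u y < c.

Definition lsc_on W u : Prop :=
  forall x, W x -> forall c, c < u x -> \forall y \near x, W y -> c < u y.

Definition local_max_on W (g : 'rV[R]_n -> R) x : Prop :=
  \forall y \near x, W y -> g y <= g x.

Definition local_min_on W (g : 'rV[R]_n -> R) x : Prop :=
  \forall y \near x, W y -> g x <= g y.

(* - plaplN p u <= f in W in the viscosity sense *)
Definition visc_plaplN_le p W u f : Prop :=
  usc_on W u /\
  forall x0 phi, W x0 -> C2_on W phi -> local_max_on W (u \- phi) x0 ->
  [/\ grad phi x0 != 0 -> - plaplN p phi x0 <= f x0,
      grad phi x0 = 0 -> 2 <= p ->
        - (p^-1 * laplacian phi x0)
        - (p - 2) / p * max_eigenvalue (hess phi x0) <= f x0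
    & grad phi x0 = 0 -> 1 < p <= 2 ->
        - (p^-1 * laplacian phi x0)
        - (p - 2) / p * min_eigenvalue (hess phi x0) <= f x0].

(* - plaplN p u >= f in W in the viscosity sense *)
Definition visc_plaplN_ge p W u f : Prop :=
  lsc_on W u /\
  forall x0 phi, W x0 -> C2_on W phi -> local_min_on W (u \- phi) x0 ->
  [/\ grad phi x0 != 0 -> f x0 <= - plaplN p phi x0,
      grad phi x0 = 0 -> 2 <= p ->
        f x0 <= - (p^-1 * laplacian phi x0)
                - (p - 2) / p * min_eigenvalue (hess phi x0)
    & grad phi x0 = 0 -> 1 < p <= 2 ->
        f x0 <= - (p^-1 * laplacian phi x0)
                - (p - 2) / p * max_eigenvalue (hess phi x0)].

End viscosity.

Section contact.
Context {R : realType} {n : nat}.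
Implicit Types (W : set 'rV[R]_n) (w : 'rV[R]_n -> R).

Definition affine (L : 'rV[R]_n -> R) : Prop :=
  exists (a : 'rV[R]_n) (b : R), forall x, L x = dotv a x + b.

Definition concave_envelope W w x : R :=
  inf [set L x | L in [set L | affine L /\ forall y, W y -> w y <= L y]].

Definition upper_contact W w : set 'rV[R]_n :=
  [set x | W x /\ w x = concave_envelope W w x].

(* Pointwise supremum of |g| over A, in [0, +oo]; it is 0 when A is empty. *)
Definition sup_norm (A : set 'rV[R]_n) (g : 'rV[R]_n -> R) : \bar R :=
  ereal_sup (0%E |` [set `|g x|%:E | x in A]).

End contact.

(* Main.v *)
(* Where u is touched from above by a concave function of the single variable x_i,
   D^2 is rank one and the viscosity inequality reads (p - 1) / p * (- w'') <= f.
   With K = p / (p - 1) and g(r) the supremum of f^+ over the contact points at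
   level r, suppose (M - m)^2 > 2 K d^2 int_m^M g. Since g is upper
   semicontinuous on each [a, M] with a > m, some continuous h > K g still has
   2 d^2 int_a^M h < (M - a)^2 for some a > m. The solution of w'' = - h(w),
   w(0) = a, whose slope satisfies w'^2 = 2 int_w^M h + const, then stays below M on
   an interval longer than d. Sliding its graph along the x_i axis until it
   touches u from above gives a touching point at level v > a, hence off the boundary;
   as w is concave, it is a contact point, and K g(v) < h(v) = - w''
   contradicts the viscosity inequality. *)

Require Import Defs.
From mathcomp Require Import all_boot all_order all_algebra.
From mathcomp Require Import all_classical all_reals all_analysis.
From mathcomp Require Import measurable_realfun ring lra.

Import Order.TTheory GRing.Theory Num.Theory.
Import numFieldNormedType.Exports.

Local Open Scope classical_set_scope.
Local Open Scope ring_scope.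

(** * Continuous majorants of semicontinuous functions *)

(** The integral of a nonnegative function is a supremum over the simple functions below it, hence
    monotone without any measurability. This permits comparison with the level supremum on [m, M]
    without first showing that it is measurable. *)
Lemma ge0_le_integral_nonmeasurable d (T : measurableType d) (R : realType)
    (mu : {measure set T -> \bar R}) (A B : set T) (f g : T -> \bar R) :
  A `<=` B -> (forall x, A x -> (0 <= f x)%E) ->
  (forall x, B x -> (0 <= g x)%E) ->
  (forall x, A x -> (f x <= g x)%E) ->
  (\int[mu]_(x in A) f x <= \int[mu]_(x in B) g x)%E.
Proof.
move=> AB f0 g0 fg; rewrite (integral_mkcond A) (integral_mkcond B).
rewrite !ge0_integralTE; [|exact: erestrict_ge0..].
apply: ereal_sup_le => _ [h hf <-]; exists h => // x.
apply: le_trans (hf x) _; rewrite /patch; case: ifPn => [/set_mem Ax|_].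
  by rewrite mem_set ?fg//; exact: AB.
by case: ifPn => // /set_mem /g0.
Qed.

Lemma lipschitz_continuous (R : realType) (h : R -> R) (k : R) :
  (forall x y, h x <= h y + k * `|x - y|) -> continuous h.
Proof.
move=> hk x; apply/cvgrPdist_lt => e e0.
have k0 : 0 < `|k| + 1 by rewrite ltr_wpDl.
exists (e / (`|k| + 1)) => /=; first by rewrite divr_gt0.
move=> y /=; rewrite ltr_pdivlMr// => xy.
have H : k * `|x - y| < e.
  apply: le_lt_trans xy; rewrite mulrC ler_wpM2l//.
  by rewrite (le_trans (ler_norm k))// lerDl.
have := hk x y; have := hk y x; rewrite (distrC y x) => h1 h2.
by rewrite ltr_norml; apply/andP; split; lra.
Qed.

(** The functions sup_s g(s) max(0, 1 - k|r - s|) + 1/(k+1) are Lipschitz, lie strictly above [g],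
    and converge to [g] pointwise by upper semicontinuity. The bound C + 1 then gives convergence of
    the integrals. *)
Lemma usc_continuous_majorant (R : realType) (g : R -> R) (a b C e : R) :
  a < b -> (forall r, a <= r <= b -> 0 <= g r <= C) ->
  (forall r c, a <= r <= b -> g r < c ->
     \forall s \near r, a <= s <= b -> g s < c) ->
  0 < e ->
  exists h : R -> R, [/\ continuous h, forall r, 0 <= h r,
    forall r, a <= r <= b -> g r < h r
  & (\int[lebesgue_measure]_(r in `[a, b]) (h r)%:E <=
     \int[lebesgue_measure]_(r in `[a, b]) (g r)%:E + e%:E)%E].
Proof.
move=> ab gb gusc e0.
have C0 : 0 <= C.
  by have /andP[] := gb a (introT andP (conj (lexx a) (ltW ab))); exact: le_trans.
pose w (k : nat) (r s : R) : R := Num.max 0 (1 - k%:R * `|r - s|).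
pose S k r := [set g s * w k r s | s in `[a, b]%classic].
pose h (k : nat) (r : R) : R := sup (S k r) + k.+1%:R^-1.
have w0 k r s : 0 <= w k r s by rewrite /w le_max lexx.
have w1 k r s : w k r s <= 1.
  by rewrite /w ge_max ler01 lerBlDr lerDl mulr_ge0.
have wL k r r' s : w k r s <= w k r' s + k%:R * `|r - r'|.
  rewrite /w ge_max; apply/andP; split.
    by rewrite addr_ge0 ?mulr_ge0// le_max lexx.
  have : 1 - k%:R * `|r' - s| <= Num.max 0 (1 - k%:R * `|r' - s|).
    by rewrite le_max lexx orbT.
  have : k%:R * `|r' - s| <= k%:R * `|r - r'| + k%:R * `|r - s|.
    rewrite -mulrDr ler_wpM2l// distrC (distrC r r').
    rewrite [X in _ <= X]addrC (_ : s - r' = (s - r) + (r - r')); last by ring.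
    by rewrite (distrC r s) (distrC r' r) ler_normD.
  lra.
have gin s : `[a, b]%classic s -> 0 <= g s <= C.
  by rewrite /= in_itv/=; exact: gb.
have S0 k r : S k r !=set0.
  by exists (g a * w k r a), a => //=; rewrite in_itv/= lexx ltW.
have SC k r : ubound (S k r) C.
  move=> _ [s /gin/andP[s0 sC] <-]; rewrite -(mulr1 C).
  by apply: ler_pM.
have Sle k r s : a <= s <= b -> g s * w k r s <= sup (S k r).
  by move=> sab; apply: ub_le_sup; [exists C; exact: SC|exists s].
have supC k r : sup (S k r) <= C by apply: ge_sup => //; exact: SC.
have sup0 k r : 0 <= sup (S k r).
  apply: le_trans (Sle k r a _); last by rewrite lexx ltW.
  rewrite mulr_ge0//.
  by have /andP[] := gb a (introT andP (conj (lexx a) (ltW ab))).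
have hcont k : continuous (h k).
  apply: (@lipschitz_continuous _ _ (C * k%:R)) => r r'.
  rewrite /h addrAC lerD2r; apply: ge_sup => // _ [s sab <-].
  have /andP[gs0 gsC] := gin _ sab.
  apply: (@le_trans _ _ (g s * (w k r' s + k%:R * `|r - r'|))).
    by rewrite ler_wpM2l.
  rewrite mulrDr lerD//; first by apply: Sle; move: sab; rewrite /= in_itv.
  by rewrite -mulrA ler_wpM2r// mulr_ge0.
have hg k r : a <= r <= b -> g r < h k r.
  move=> rab; have := Sle k r r rab.
  rewrite /w subrr normr0 mulr0 subr0 (max_idPr _)// mulr1 => H.
  by rewrite /h ltr_pwDr.
have hlim r : a <= r <= b -> h ^~ r @ \oo --> g r.
  move=> rab; apply/cvgrPdist_le => eps eps0.
  have eps20 : 0 < eps / 2 by rewrite divr_gt0.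
  have /(gusc _ _ rab) : g r < g r + eps / 2 by rewrite ltrDl.
  move=> [d /= d0 dP].
  near=> k.
  rewrite distrC ger0_norm; last by rewrite subr_ge0 ltW// hg.
  have k1 : k.+1%:R^-1 <= eps / 2.
    by apply/ltW; near: k; exact: (near_infty_natSinv_lt (PosNum eps20)).
  suff H : sup (S k r) <= g r + eps / 2.
    by rewrite /h lerBlDl (le_trans (lerD H k1))// -addrA -splitr.
  (* Upper semicontinuity controls the s within d of r; the weight of all others vanishes once k d
     >= 1. *)
  apply: ge_sup => // _ [s sab <-].
  have /andP[gr0 _] := gb r rab.
  have /andP[gs0 gsC] := gin _ sab.
  have [rs|rs] := ltP `|r - s| d.
    rewrite -[X in _ <= X]mulr1; apply: ler_pM => //; exact/ltW/dP.
  suff -> : w k r s = 0 by rewrite mulr0 addr_ge0// ltW.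
  apply/max_idPl; rewrite subr_le0.
  apply: (@le_trans _ _ (k%:R * d)); last by rewrite ler_wpM2l.
  rewrite -ler_pdivrMr// mul1r.
  by near: k; exact: nbhs_infty_ger.
have mh k : measurable_fun `[a, b] (EFin \o h k).
  apply/measurable_EFinP.
  by apply: measurable_funS (continuous_measurable_fun (hcont k)).
(* Measurability of [g] comes from the pointwise limit of the continuous [h k]. *)
have mg : measurable_fun `[a, b] (EFin \o g).
  apply/measurable_EFinP; apply: (@measurable_fun_cvg _ _ _ _ h).
    by move=> k; apply/measurable_EFinP.
  by move=> r; rewrite /= in_itv/= => /hlim.
have [| | |ig _ +] := @dominated_convergence _ _ R lebesgue_measure _
  (measurable_itv `[a, b])
  (fun k => EFin \o h k) (EFin \o g) (cst (C + 1)%:E) mh mg.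
- by apply: aeW => r; rewrite /= in_itv/= => /hlim H; apply: cvg_EFin H; exact: nearW.
- apply: (@continuous_compact_integrable _ (cst (C + 1))).
    exact: segment_compact.
  by apply: continuous_subspaceT => x; exact: cvg_cst.
- apply: aeW => r n; rewrite /= in_itv/= => rab.
  rewrite lee_fin ger0_norm ?addr_ge0 ?invr_ge0// /h lerD//.
  by rewrite invf_le1// ler1n.
have Ifin : (\int[lebesgue_measure]_(x in `[a, b]) (EFin \o g) x)%E \is a fin_num.
  by apply: integrable_fin_num ig => //; exact: measurable_itv.
rewrite -(fineK Ifin) => /fine_cvgP[finh /cvgrPdist_lt/(_ _ e0) clim].
near \oo => k.
exists (h k); split => //.
- by move=> r; rewrite addr_ge0.
- by move=> r; exact: hg.
- have fk : (\int[lebesgue_measure]_(x in `[a, b]) (EFin \o h k) x)%E \is a fin_num.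
    by near: k.
  rewrite -(fineK fk) -EFinD lee_fin.
  have : `|fine (\int[lebesgue_measure]_(x in `[a, b]) (EFin \o g) x)%E -
     fine (\int[lebesgue_measure]_(x in `[a, b]) (EFin \o h k) x)%E| < e.
    by near: k.
  rewrite ltr_distlC => /andP[_ /ltW]; exact.
Unshelve. all: by end_near. Qed.

(** * A one-dimensional barrier *)

Lemma is_derive1_continuous (R : realType) (f : R -> R) (x d : R) :
  is_derive x 1 f d -> {for x, continuous f}.
Proof. by case=> + _ => /derivable1_diffP /differentiable_continuous. Qed.

Lemma primitive_exists (R : realType) (k : R -> R) (a b : R) :
  (forall x, a <= x <= b -> {for x, continuous k}) ->
  exists G : R -> R, forall x, a < x < b -> is_derive x 1 G (k x).
Proof.
move=> kc; pose G x := \int[lebesgue_measure]_(t in `[a, x]) k t.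
exists G => x /andP[ax xb].
have ki : lebesgue_measure.-integrable `[a, b] (EFin \o k).
  apply: continuous_compact_integrable; first exact: segment_compact.
  by apply: continuous_in_subspaceT => y; rewrite inE/= in_itv/=; exact: kc.
have kx : {for x, continuous k} by apply: kc; rewrite !ltW.
have [dG <-] := continuous_FTC1_closed xb ki ax kx.
by rewrite derive1E; exact: derivableP.
Qed.

(** The two sign conditions place c between s and t whatever their order, so points on either side
    of s are treated together. *)
Lemma MVT_from (R : realType) (f df : R -> R) (a b s t : R) :
  (forall x, a < x < b -> is_derive x 1 f (df x)) ->
  a < s < b -> a < t < b ->
  exists c, [/\ a < c < b, f t - f s = df c * (t - s), 0 <= (c - s) * (t - s)
    & 0 <= (t - c) * (t - s)].
Proof.
move=> fd sab tab.
wlog st : s t sab tab / s <= t => [H|].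
  have [/H|/ltW st] := leP s t; first by apply.
  have [c [cab E c1 c2]] := H _ _ tab sab st; exists c; split => //.
  - by rewrite -opprB E; ring.
  - by rewrite -mulrNN !opprB.
  - by rewrite -mulrNN !opprB.
have sub x : s <= x <= t -> a < x < b.
  by move=> ?; lra.
have [||c] := @MVT_segment R f df s t st.
- by move=> x; rewrite in_itv/= => /andP[sx xt]; apply: fd; apply: sub; rewrite !ltW.
- apply: continuous_in_subspaceT => x; rewrite inE/= in_itv/= => /sub/fd.
  exact: is_derive1_continuous.
rewrite in_itv/= => /[dup] /sub cab /andP[sc ct] E.
by exists c; split => //; rewrite mulr_ge0// subr_ge0.
Qed.

(* T is the inverse of an increasing solution w of w'' = - h(w), and F v is the
   slope of w where w = v, so that F^2 = 2 int_v^b h + const. *)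
Lemma barrier (R : realType) (h : R -> R) (A a b B d : R) :
  continuous h -> (forall r, 0 <= h r) -> A < a -> a < b -> b < B -> 0 < d ->
  ((2 * d ^+ 2)%:E * \int[lebesgue_measure]_(r in `[a, b]) (h r)%:E <
   ((b - a) ^+ 2)%:E)%E ->
  exists T F : R -> R, [/\
    forall v, A < v < B -> {for v, continuous T} /\ 0 < F v,
    forall v w, A < v < B -> A < w < B -> v < w -> T v < T w,
    d < T b - T a,
    forall v w, A < v < B -> A < w < B -> w - v <= F v * (T w - T v)
  & forall v c, A < v <= b -> c < h v ->
      \forall t \near 0, A < v + F v * t - c / 2 * t ^+ 2 /\
        T v + t <= T (v + F v * t - c / 2 * t ^+ 2)].
Proof.
move=> hc h0 Aa ab bB d0.
(* [primitive_exists] asks for continuity on a closed interval and gives derivatives only inside it;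
   the margins 2 and then 1 leave room for [G] and then [T]. *)
have [|G dG] := @primitive_exists R h (A - 2) (B + 2); first by move=> ? _; exact: hc.
have cG v : A - 2 < v < B + 2 -> {for v, continuous G}.
  by move=> /dG; exact: is_derive1_continuous.
have Gmono v w : A - 2 < v < B + 2 -> A - 2 < w < B + 2 -> v <= w -> G v <= G w.
  move=> vi wi vw; have [c [_ E _ _]] := MVT_from _ _ _ _ _ _ _ dG vi wi.
  by rewrite -subr_ge0 E mulr_ge0// subr_ge0.
have -> : (\int[lebesgue_measure]_(r in `[a, b]) (h r)%:E = (G b - G a)%:E)%E.
  rewrite EFinB; apply: continuous_FTC2 => //.
  - exact: continuous_subspaceT.
  - split=> [x||].
    + by rewrite in_itv/= => xab; have [] : is_derive x 1 G (h x) by apply: dG; lra.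
    + by apply: cvg_at_right_filter; apply: cG; lra.
    + by apply: cvg_at_left_filter; apply: cG; lra.
  - move=> x; rewrite in_itv/= derive1E => xab.
    by have [_] : is_derive x 1 G (h x) by apply: dG; lra.
rewrite -EFinM lte_fin => Glt.
(* [e2] is the squared slope left at height b. With this value d^2 F(a)^2 is the midpoint of 2 d^2
   int_a^b h and (b - a)^2, so d F(a) < b - a, while T b - T a >= (b - a) / F a because F
   decreases. *)
pose e2 := ((b - a) ^+ 2 - 2 * d ^+ 2 * (G b - G a)) / (2 * d ^+ 2).
have e20 : 0 < e2 by rewrite divr_gt0 ?subr_gt0// mulr_gt0 ?exprn_gt0.
pose E v := e2 + 2 * (G b - G v).
(* The maximum only matters beyond b, where it keeps F positive. *)
pose F v := Num.sqrt (Num.max (e2 / 2) (E v)).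
have F0 v : 0 < F v by rewrite sqrtr_gt0 lt_max divr_gt0.
have FE v : e2 / 2 <= E v -> F v ^+ 2 = E v.
  move=> Ev; rewrite sqr_sqrtr ?(max_idPr _)//.
  by rewrite (le_trans _ Ev)// ltW// divr_gt0.
have EF v : A - 2 < v <= b -> F v ^+ 2 = E v.
  move=> vb; apply: FE; rewrite /E.
  have : G v <= G b by apply: Gmono; lra.
  lra.
have Fmono v w : A - 2 < v < B + 2 -> A - 2 < w < B + 2 -> v <= w -> F w <= F v.
  move=> vi wi vw; rewrite ler_wsqrtr// ge_max !le_max lexx/=; apply/orP; right.
  by rewrite lerD2l ler_pM2l// lerD2l lerN2 Gmono.
have cF v : A - 2 < v < B + 2 -> {for v, continuous F}.
  move=> vi; rewrite /F.
  apply: (@continuous_comp _ _ _ (fun v => Num.max (e2 / 2) (E v)) Num.sqrt);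
    last exact: sqrt_continuous.
  apply: (@continuous_max _ _ (cst (e2 / 2)) E); first exact: cvg_cst.
  apply: cvgD; first exact: cvg_cst.
  apply: cvgM; first exact: cvg_cst.
  by apply: cvgB; [exact: cvg_cst|exact: cG].
have [|T dT] := @primitive_exists R (fun v => (F v)^-1) (A - 1) (B + 1).
  by move=> x xi; apply: cvgV; [rewrite gt_eqF|apply: cF; lra].
have Ti v w : A < v < B -> A < w < B -> exists c,
   [/\ A - 1 < c < B + 1, T w - T v = (F c)^-1 * (w - v), 0 <= (c - v) * (w - v)
    & 0 <= (w - c) * (w - v)].
  by move=> vi wi; apply: MVT_from dT _ _; lra.
exists T, F; split.
- move=> v vi; split=> //.
  by apply: is_derive1_continuous; apply: dT; lra.
- move=> v w vi wi vw; have [c [ci H _ _]] := Ti v w vi wi.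
  by rewrite -subr_gt0 H mulr_gt0 ?invr_gt0 ?subr_gt0.
- have [||c [ci H c1 _]] := Ti a b; [lra|lra|].
  rewrite H mulrC ltr_pdivlMr//.
  have ac : a <= c by move: c1; rewrite pmulr_lge0 ?subr_gt0// subr_ge0.
  apply: (@le_lt_trans _ _ (d * F a)).
    by rewrite ler_pM2l// Fmono//; lra.
  rewrite -(@ltr_pXn2r _ 2)// ?nnegrE ?mulr_ge0 ?subr_ge0 ?(ltW d0) ?(ltW ab) ?(ltW (F0 _))//.
  rewrite exprMn EF; last lra.
  rewrite /E; have -> : d ^+ 2 * (e2 + 2 * (G b - G a)) =
    ((b - a) ^+ 2 + 2 * d ^+ 2 * (G b - G a)) / 2.
    by rewrite /e2; field; rewrite gt_eqF.
  by move: Glt; set X := _ ^+ 2; set Y := _ * (G b - G a); lra.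
(* As F decreases, the inverse of T is concave and lies below its tangent at height v. *)
- move=> v w vi wi; have [c [ci H c1 _]] := Ti v w vi wi.
  rewrite H mulrA; have [vw|wv|->] := ltgtP v w; last by rewrite subrr mulr0.
  + rewrite ler_peMl ?subr_ge0 ?(ltW vw)// ler_pdivlMr// mul1r.
    apply: Fmono; [lra|lra|].
    by move: c1; rewrite pmulr_lge0 ?subr_gt0// subr_ge0.
  + rewrite -[X in X <= _]mul1r ler_nM2r ?subr_lt0// ler_pdivrMr// mul1r.
    apply: Fmono; [lra|lra|].
    by move: c1; rewrite nmulr_lge0 ?subr_lt0// subr_le0.
- move=> v c vb chv.
  (* [psi] has the height and slope of the barrier at v but second derivative - c > - h v, so it
     should lie above the barrier near t = 0. *)
  pose psi (t : R) := v + F v * t - c / 2 * t ^+ 2.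
  have dpsi (t : R) : is_derive t 1 psi (F v - c * t).
    rewrite (_ : psi = cst v + (F v \*: id) - (c / 2) \*: (id ^+ 2)); last first.
      by apply/funext => s; rewrite /psi !fctE.
    apply: is_derive_eq; rewrite /GRing.scale/= expr1; field => //.
  have psi0 : psi 0 = v by rewrite /psi; ring.
  have cpsi : {for 0, continuous psi} := is_derive1_continuous _ _ _ _ (dpsi 0).
  (* The strict slack makes F^2 = E hold on both sides of v, even for v = b. *)
  have Ev : e2 / 2 < E v.
    have : G v <= G b by apply: Gmono; lra.
    by rewrite /E; lra.
  have cE : {for v, continuous E}.
    apply: cvgD; first exact: cvg_cst.
    apply: cvgM; first exact: cvg_cst.
    by apply: cvgB; [exact: cvg_cst|apply: cG; lra].
  have : \forall t \near 0, [/\ A < psi t, psi t < B, e2 / 2 < E (psi t),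
       c < h (psi t) & 0 < F v - c * t].
    near=> t; split.
    - near: t; apply: (cvgr_gt (psi 0)); [exact: cpsi|rewrite psi0; lra].
    - near: t; apply: (cvgr_lt (psi 0)); [exact: cpsi|rewrite psi0; lra].
    - near: t; apply: (cvgr_gt (E (psi 0))); last by rewrite psi0.
      by apply: (@continuous_comp _ _ _ psi E) => //; rewrite psi0.
    - near: t; apply: (cvgr_gt (h (psi 0))); last by rewrite psi0.
      by apply: (@continuous_comp _ _ _ psi h) => //; exact: hc.
    - near: t; apply: (cvgr_gt (F v - c * 0)); last by rewrite mulr0 subr0.
      by apply: cvgB; [exact: cvg_cst|apply: cvgM; [exact: cvg_cst|exact: cvg_id]].
  move=> [r /= r0 rP].
  have {}rP t : - r < t < r -> [/\ A < psi t, psi t < B, e2 / 2 < E (psi t),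
       c < h (psi t) & 0 < F v - c * t].
    by move=> tr; apply: rP; rewrite /= sub0r normrN ltr_norml.
  (* D vanishes at 0 and increases, so psi' - F (psi) has the sign of t, and
     T (psi t) - t is minimal at 0. *)
  pose D t := (F v - c * t) ^+ 2 - E (psi t).
  have dD t : - r < t < r ->
     is_derive t 1 D (2 * (F v - c * t) * (h (psi t) - c)).
    move=> /rP[? ? _ _ _].
    have dGt : is_derive t 1 (G \o psi) (h (psi t) * (F v - c * t)).
      by apply: is_derive1_comp; apply: dG; lra.
    rewrite (_ : D = (cst (F v) - c \*: id) ^+ 2 -
      (cst e2 + (2 : R) \*: (cst (G b) - G \o psi))); last first.
      by apply/funext => s; rewrite /D /E !fctE.
    apply: is_derive_eq; rewrite !fctE /GRing.scale/= expr1 -[c *: t]/(c * t); ring.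
  have dth t : - r < t < r ->
     is_derive t 1 (fun t => T (psi t) - t) ((F (psi t))^-1 * (F v - c * t) - 1).
    move=> /rP[? ? _ _ _].
    have dTt : is_derive t 1 (T \o psi) ((F (psi t))^-1 * (F v - c * t)).
      by apply: is_derive1_comp; apply: dT; lra.
    exact: (@is_deriveB _ _ _ (T \o psi) id).
  have D0 : D 0 = 0 by rewrite /D mulr0 subr0 psi0 EF ?subrr; lra.
  have r0i : - r < 0 < r by lra.
  exists r => // t; rewrite /= sub0r normrN ltr_norml => tr.
  split; first by have [] := rP t tr.
  have [z [zr Ez z0 zt]] := MVT_from _ _ _ _ _ _ _ dth r0i tr.
  suff : 0 <= ((F (psi z))^-1 * (F v - c * z) - 1) * (t - 0).
    by rewrite -Ez psi0 -/(psi t); lra.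
  have [y [yr + _ _]] := MVT_from _ _ _ _ _ _ _ dD r0i zr.
  move: z0; rewrite D0 !subr0 => z0 Dz.
  have [_ _ Ez2 _ pz0] := rP z zr.
  have [_ _ _ hy py0] := rP y yr.
  have k0 : 0 < 2 * (F v - c * y) * (h (psi y) - c).
    by apply: mulr_gt0; [exact: mulr_gt0|rewrite subr_gt0].
  have [t0|t0|->] := ltgtP t 0; last by rewrite mulr0.
    rewrite nmulr_lge0// subr_le0 mulrC ler_pdivrMr// mul1r.
    rewrite -(@ler_pXn2r _ 2)// ?nnegrE ?(ltW pz0) ?(ltW (F0 _))// FE ?(ltW Ez2)//.
    rewrite nmulr_lge0// in z0.
    by rewrite -subr_le0 -/(D z) Dz mulr_ge0_le0// ltW.
  rewrite pmulr_lge0// subr_ge0 mulrC ler_pdivlMr// mul1r.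
  rewrite -(@ler_pXn2r _ 2)// ?nnegrE ?(ltW pz0) ?(ltW (F0 _))// FE ?(ltW Ez2)//.
  rewrite pmulr_lge0// in z0.
  by rewrite -subr_ge0 -/(D z) Dz mulr_ge0// ltW.
Unshelve. all: by end_near. Qed.

(** * The normalized p-Laplacian of functions of one coordinate *)

(** Along the i-th axis the difference quotient is that of [q]; along any other axis it is
    identically zero. *)
Lemma is_derive_coord (R : realType) (n : nat) (q : R -> R) (y : 'rV[R]_n)
    (i j : 'I_n) (d : R) :
  is_derive (y 0 i) 1 q d ->
  is_derive y (delta_mx 0 j) (fun z : 'rV[R]_n => q (z 0 i)) ((j == i)%:R * d).
Proof.
move=> qd; have [->|ji] := eqVneq j i.
  rewrite mul1r.
  have E : (fun h : R => h^-1 *: (((fun z : 'rV[R]_n => q (z 0 i)) \o shift y)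
      (h *: delta_mx 0 i) - q (y 0 i))) =
    (fun h : R => h^-1 *: ((q \o shift (y 0 i)) (h *: 1) - q (y 0 i))).
    by apply/funext => h /=; rewrite !mxE !eqxx.
  by case: qd => qd1 qd2; split; rewrite /derivable /derive E.
rewrite mul0r.
have E : (fun h : R => h^-1 *: (((fun z : 'rV[R]_n => q (z 0 i)) \o shift y)
      (h *: delta_mx 0 j) - q (y 0 i))) = (fun h : R => 0).
  apply/funext => h /=; rewrite !mxE (eq_sym i) (negbTE ji) andbF.
  by rewrite mulr0 add0r subrr scaler0.
split; rewrite /derivable /derive E; first exact: is_cvg_cst.
exact: lim_cst.
Qed.

Lemma partial_coord (R : realType) (n : nat) (q dq : R -> R) (i j : 'I_n) :
  (forall s : R, is_derive s 1 q (dq s)) ->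
  partial j (fun z : 'rV[R]_n => q (z 0 i)) =
  (fun z : 'rV[R]_n => (j == i)%:R * dq (z 0 i)).
Proof.
move=> qd; apply/funext => z; rewrite /partial.
by have [_] := @is_derive_coord _ _ q z i j _ (qd _).
Qed.

Lemma C2_on_coord (R : realType) (n : nat) (W : set 'rV[R]_n)
    (q dq ddq : R -> R) (i : 'I_n) :
  (forall s : R, is_derive s 1 q (dq s)) -> (forall s : R, is_derive s 1 dq (ddq s)) ->
  continuous ddq ->
  C2_on W (fun z : 'rV[R]_n => q (z 0 i)).
Proof.
move=> dq1 dq2 cddq.
have cont (r : R -> R) : continuous r ->
    {within W, continuous (fun z : 'rV[R]_n => r (z 0 i))}.
  move=> cr; apply: continuous_subspaceT => z.
  apply: (@continuous_comp _ _ _ (fun z : 'rV[R]_n => z 0 i) r).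
    exact: coord_continuous.
  exact: cr.
have dcont (r dr : R -> R) :
    (forall s : R, is_derive s 1 r (dr s)) -> continuous r.
  by move=> rdr s; exact: is_derive1_continuous (rdr s).
have dq3 (j : 'I_n) (s : R) :
    is_derive s 1 (fun s => (j == i)%:R * dq s) ((j == i)%:R * ddq s).
  exact: is_deriveZ.
split; first exact/cont/dcont.
- move=> j; split.
    by move=> z _; have [] := @is_derive_coord _ _ q z i j _ (dq1 _).
  rewrite (partial_coord _ _ _ _ _ j dq1).
  by apply: (cont (fun s => (j == i)%:R * dq s)); exact: dcont _ _ (dq3 j).
- move=> k j; rewrite (partial_coord _ _ _ _ _ j dq1); split.
    by move=> z _; have [] := @is_derive_coord _ _ _ z i k _ (dq3 j _).
  rewrite (partial_coord _ _ _ _ _ k (dq3 j)).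
  apply: (cont (fun s => (k == i)%:R * ((j == i)%:R * ddq s))) => s.
  apply: cvgM; first exact: cvg_cst.
  by apply: cvgM; [exact: cvg_cst|exact: cddq].
Qed.

Lemma grad_coord (R : realType) (n : nat) (q dq : R -> R) (i : 'I_n) (z : 'rV[R]_n) :
  (forall s : R, is_derive s 1 q (dq s)) ->
  grad (fun z : 'rV[R]_n => q (z 0 i)) z = dq (z 0 i) *: delta_mx 0 i.
Proof.
move=> qd; apply/rowP => j; rewrite !mxE (partial_coord _ _ _ _ _ j qd) eqxx/=.
by rewrite mulrC eq_sym.
Qed.

Lemma enorm_scale_delta (R : realType) (n : nat) (a : R) (i : 'I_n) :
  enorm (a *: delta_mx 0 i) = `|a|.
Proof.
rewrite /enorm /dotv (bigD1 i)//= big1 => [|j ji].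
  by rewrite !mxE !eqxx mulr1 addr0 -expr2 sqrtr_sqr.
by rewrite !mxE (negbTE ji) andbF !mulr0.
Qed.

(** The gradient is q' e_i, so the divergence reduces to the derivative (p - 1)|q'|^(p-2) q'' of
    |q'|^(p-2) q', and the prefactor |q'|^(2-p) cancels the power. *)
Lemma plaplN_coord (R : realType) (n : nat) (p : R) (q dq ddq : R -> R) (i : 'I_n)
    (z : 'rV[R]_n) :
  (forall s : R, is_derive s 1 q (dq s)) -> (forall s : R, is_derive s 1 dq (ddq s)) ->
  dq (z 0 i) != 0 ->
  plaplN p (fun z : 'rV[R]_n => q (z 0 i)) z = (p - 1) / p * ddq (z 0 i).
Proof.
move=> qd dqd dq0.
rewrite /plaplN (grad_coord _ _ _ _ _ _ qd) enorm_scale_delta /divergence.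
set a := z 0 i in dq0 *.
pose r s := `|dq s| `^ (p - 2) * dq s.
have E j : (fun y : 'rV[R]_n =>
    (enorm (grad (fun z => q (z 0 i)) y) `^ (p - 2) *:
     grad (fun z => q (z 0 i)) y) 0 j) =
  (fun y => (fun s => (j == i)%:R * r s) (y 0 i)).
  apply/funext => y; rewrite (grad_coord _ _ _ _ _ _ qd) enorm_scale_delta !mxE /= mulrA.
  by rewrite mulrC; congr (_%:R * _); rewrite eq_sym.
have dr : is_derive a 1 r ((p - 1) * `|dq a| `^ (p - 2) * ddq a).
  (* Near a the sign of q' is constant, so [r] equals sg (sg q')^(p-1), a power of a positive
     base. *)
  pose sg := Num.sg (dq a).
  have dsg : is_derive a 1 (fun s => sg * dq s) (sg * ddq a) by exact: is_deriveZ.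
  have sg0 : 0 < sg * dq a by rewrite -normrEsg normr_gt0.
  have cdq : {for a, continuous (fun s => sg * dq s)}.
    exact: is_derive1_continuous dsg.
  have sg2 : sg * sg = 1 by rewrite -expr2 sqr_sg dq0.
  apply: (@near_eq_is_derive _ _ _ (fun s => sg * (sg * dq s) `^ (p - 1))).
    near=> s.
    have s0 : 0 < sg * dq s by near: s; exact: (cvgr_gt _ cdq _ sg0).
    have E1 : `|dq s| = sg * dq s.
      by rewrite -[RHS]gtr0_norm// normrM /sg normr_sg dq0 mul1r.
    rewrite /r E1 (_ : p - 1 = (p - 2) + 1); last by ring.
    rewrite [_ `^ (p - 2 + 1)]powRD ?(gt_eqF s0) ?implybT// powRr1 ?(ltW s0)//.
    by rewrite mulrCA (mulrA sg sg) sg2 mul1r.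
  have H := @is_derive1_comp _ (fun s => s `^ (p - 1)) _ a _ _
    (is_derive1_powR (p - 1) sg0) dsg.
  refine (is_derive_eq (is_deriveZ sg H) _).
  rewrite -normrEsg /GRing.scale/= (_ : p - 1 - 1 = p - 2); last by ring.
  by rewrite -[RHS]mul1r -sg2; ring.
rewrite (bigD1 i)//= big1 ?addr0; last first.
  move=> j ji; rewrite E (negbTE ji) /partial.
  have [_ ->] := @is_derive_coord _ _ _ z i j _ (is_deriveZ (0 : R) dr).
  by rewrite (negbTE ji) mul0r.
rewrite E eqxx /partial.
have [_ ->] := @is_derive_coord _ _ _ z i i _ (is_deriveZ (1 : R) dr).
rewrite eqxx mul1r scale1r.
have ab : `|dq a| `^ (2 - p) * `|dq a| `^ (p - 2) = 1.
  rewrite -powRD ?normr_eq0 ?dq0 ?implybT//.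
  by rewrite (_ : 2 - p + (p - 2) = 0) ?powRr0//; ring.
rewrite [LHS](_ : _ = `|dq a| `^ (2 - p) * `|dq a| `^ (p - 2) *
  ((p - 1) / p * ddq a)); last by ring.
by rewrite ab mul1r.
Unshelve. all: by end_near. Qed.

(** * Contact sets *)

Lemma within_continuous_near (R : realType) (T : topologicalType) (C : set T)
    (u : T -> R) (x : T) (P : set R) :
  {within C, continuous u} -> C x -> nbhs (u x) P ->
  \forall y \near x, C y -> P (u y).
Proof.
move=> cu Cx nP; have := cu x _ nP.
by rewrite /nbhs/= /nbhs_subspace /= mem_set.
Qed.

Lemma closed_ge_within (R : realType) (T : topologicalType) (C : set T)
    (u : T -> R) (a : R) :
  closed C -> {within C, continuous u} -> closed [set x | C x /\ a <= u x].
Proof.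
move=> clC cu x xcl.
have Cx : C x by apply: clC => B /xcl [y [[Cy _] By]]; exists y.
split=> //; rewrite leNgt; apply/negP => ua.
have N := within_continuous_near _ _ _ _ _ _ cu Cx (lt_nbhsl ua).
by have [y [[Cy ay] /(_ Cy) /=]] := xcl _ N; rewrite ltNge ay.
Qed.

Section contact_lemmas.
Variables (R : realType) (n : nat).
Implicit Types (W : set 'rV[R]_n) (u : 'rV[R]_n -> R).

Lemma dotvDr (a x y : 'rV[R]_n) : dotv a (x + y) = dotv a x + dotv a y.
Proof. by rewrite /dotv -big_split; apply: eq_bigr => i _; rewrite !mxE mulrDr. Qed.

Lemma dotvZr (a x : 'rV[R]_n) (t : R) : dotv a (t *: x) = t * dotv a x.
Proof. by rewrite /dotv mulr_sumr; apply: eq_bigr => i _; rewrite !mxE mulrCA. Qed.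

Lemma dotvZ_delta (b : R) (i : 'I_n) (y : 'rV[R]_n) :
  dotv (b *: delta_mx 0 i) y = b * y 0 i.
Proof.
rewrite /dotv (bigD1 i)//= big1 => [|j ji].
  by rewrite !mxE !eqxx mulr1 addr0.
by rewrite !mxE (negbTE ji) andbF mulr0 mul0r.
Qed.

Lemma affine_cst (M : R) : affine (cst M : 'rV[R]_n -> R).
Proof.
exists 0, M => y.
by rewrite /dotv big1 ?add0r// => k _; rewrite mxE mul0r.
Qed.

(** The bound M supplies a constant majorant; without a majorant [inf] would take its default value
    0. *)
Lemma concave_envelope_ge W u x M :
  W x -> (forall y, W y -> u y <= M) -> u x <= concave_envelope W u x.
Proof.
move=> Wx uM; apply: lb_le_inf.
  by exists M, (cst M) => //; split=> //; exact: affine_cst.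
by move=> _ [L [_ uL] <-]; exact: uL.
Qed.

Lemma concave_envelope_le W u x (L : 'rV[R]_n -> R) :
  W x -> affine L -> (forall y, W y -> u y <= L y) ->
  concave_envelope W u x <= L x.
Proof.
move=> Wx aL uL; apply: ge_inf; last by exists L.
by exists (u x) => _ [L' [_ uL'] <-]; exact: uL'.
Qed.

(** An affine majorant that equals u at x squeezes the envelope there. Slopes along the i-th axis
    suffice because the barrier depends on x_i alone. *)
Lemma upper_contact_support W u x (b : R) (i : 'I_n) :
  W x -> (forall y, W y -> u y <= u x + b * (y 0 i - x 0 i)) ->
  (exists M, forall y, W y -> u y <= M) ->
  upper_contact W u x.
Proof.
move=> Wx ub [M uM]; split=> //; apply/eqP; rewrite eq_le.
rewrite (@concave_envelope_ge _ _ _ M)//=.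
rewrite (le_trans (@concave_envelope_le _ _ _
  (fun y => u x + b * (y 0 i - x 0 i)) _ _ _))//.
  by exists (b *: delta_mx 0 i), (u x - b * x 0 i) => y; rewrite dotvZ_delta; ring.
by rewrite subrr mulr0 addr0.
Qed.

(* An almost touching affine majorant L at y close to x has
   L x - L y = (L y - L z) / t for z = y + t (y - x), and L z >= u z. *)
Lemma upper_contact_closed W u x M :
  open W -> {in W, continuous u} -> (forall y, W y -> u y <= M) ->
  W x -> closure (upper_contact W u) x -> upper_contact W u x.
Proof.
move=> oW cu uM Wx clx; split=> //; apply/eqP; rewrite eq_le.
rewrite (@concave_envelope_ge _ _ _ M)//=.
apply/ler_addgt0Pr => e e0.
have e30 : 0 < e / 3 by rewrite divr_gt0.
(* The tolerances 1 give L y - L z < 3, hence L x - L y <= 3 / t = e / 3. *)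
pose t := 3 / (e / 3); have t0 : 0 < t by rewrite divr_gt0.
have cux : {for x, continuous u} by apply: cu; rewrite inE.
have : \forall y \near x, W y /\ `|u x - u y| < Num.min 1 (e / 3).
  near=> y; split.
    by near: y; exact: open_nbhs_nbhs.
  near: y; have /cvgrPdist_lt := cux; apply.
  by rewrite lt_min ltr01.
move=> /nbhs_ballP [r /= r0 rP].
(* The reflected point z lies at distance (1 + t)|x - y| from x, which must stay below r. *)
have d0 : 0 < r / (1 + t) by rewrite divr_gt0// addr_gt0.
have [y [[Wy uy] yx]] := clx _ (nbhsx_ballx x _ d0).
have t1 : 0 < 1 + t by rewrite addr_gt0.
have xyr : (1 + t) * `|x - y| < r.
  by move: yx; rewrite -ball_normE /= ltr_pdivlMr// mulrC.
have yr : ball x r y.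
  rewrite -ball_normE /=; apply: le_lt_trans xyr.
  by rewrite ler_peMl// lerDl ltW.
have zr : ball x r (y + t *: (y - x)).
  rewrite -ball_normE /= (_ : x - _ = (1 + t) *: (x - y)).
    by rewrite normrZ gtr0_norm.
  by rewrite scalerDl scale1r -(opprB x y) scalerN opprD opprK addrA.
have [_] := rP _ yr; have [Wz] := rP _ zr.
rewrite !lt_min !ltr_distlC => /andP[/andP[uz1 _] _] /andP[/andP[_ uy1] /andP[_ uy2]].
have : concave_envelope W u y < u y + Num.min 1 (e / 3).
  by rewrite -uy ltrDl lt_min ltr01.
move=> /inf_lt [].
  by exists M, (cst M) => //; split=> //; exact: affine_cst.
move=> _ [L [aL uL] <-] Ly.
apply: (le_trans (concave_envelope_le _ _ _ _ Wx aL uL)).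
have Lz := uL _ Wz.
have : L (y + t *: (y - x)) = L y + t * (L y - L x).
  case: aL => a [b Lab]; rewrite !Lab dotvDr dotvZr dotvDr -scaleN1r dotvZr; ring.
move=> Lzt.
have [Ly1 Ly2] : L y < u y + 1 /\ L y < u y + e / 3.
  by move: Ly; rewrite -ltrBlDl lt_min !ltrBlDl => /andP.
have : t * (L x - L y) <= 3 by lra.
rewrite -ler_pdivlMl// => H.
have : t^-1 * 3 = e / 3 by rewrite /t; field; rewrite gt_eqF.
lra.
Unshelve. all: by end_near. Qed.

End contact_lemmas.

(** * Coordinates, Euclidean diameter and compactness *)

Section geometry.
Variables (R : realType) (n : nat).
Implicit Types (W : set 'rV[R]_n) (x y : 'rV[R]_n) (i : 'I_n).

Lemma coord_le_norm x i : `|x 0 i| <= `|x|.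
Proof.
by rewrite [leRHS]/Num.norm /= mx_normrE; apply/bigmax_geP; right => /=; exists (0, i).
Qed.

Lemma coord_le_enorm x i : `|x 0 i| <= enorm x.
Proof.
rewrite -sqrtr_sqr ler_wsqrtr// /dotv (bigD1 i)//= expr2 lerDl.
by apply: sumr_ge0 => j _; rewrite -expr2 sqr_ge0.
Qed.

(** Boundedness makes the real [sup] in [ediam] an upper bound: if the sup norm is below B on W,
    Euclidean distances are at most sqrt(n (2B)^2). *)
Lemma coord_sub_le_ediam W x y i :
  bounded_set W -> W x -> W y -> x 0 i - y 0 i <= ediam W.
Proof.
move=> /ex_strict_bound_gt0[B B0 WB] Wx Wy.
apply: (@le_trans _ _ (enorm (x - y))).
  by rewrite (le_trans _ (coord_le_enorm _ i))// !mxE ler_norm.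
apply: ub_le_sup; last by exists (x, y).
exists (Num.sqrt (n%:R * (2 * B) ^+ 2)) => _ [[a b] [/= Wa Wb] <-].
rewrite ler_wsqrtr// /dotv -[n in n%:R]card_ord -sum1_card natr_sum mulr_suml.
apply: ler_sum => j _; rewrite mul1r -expr2 -[leLHS]real_normK ?num_real//.
rewrite ler_pXn2r ?nnegrE ?mulr_ge0 ?(ltW B0)//.
apply: (le_trans (coord_le_norm _ _)).
apply: (le_trans (ler_normB _ _)).
by rewrite mulr_natl mulr2n lerD// ltW//; exact: WB.
Qed.

(** W contains a short segment along the i-th axis. The index i excludes dimension zero, where the
    diameter vanishes. *)
Lemma ediam_gt0 W x i : open W -> bounded_set W -> W x -> 0 < ediam W.
Proof.
move=> oW bW Wx.
have /nbhs_ballP [r /= r0 rW] : nbhs x W by exact: open_nbhs_nbhs.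
have r20 : 0 < r / 2 by rewrite divr_gt0.
have Wy : W (x + (r / 2) *: delta_mx 0 i).
  apply: rW; rewrite -ball_normE /= opprD addrA subrr add0r normrN normrZ gtr0_norm//.
  apply: (@le_lt_trans _ _ (r / 2)); last by rewrite ltr_pdivrMr// mulr_natr mulr2n ltrDl.
  rewrite ler_piMr ?(ltW r20)// [leLHS]/Num.norm /= mx_normrE.
  apply/bigmax_leP; split=> // j _; rewrite !mxE.
  by case: (_ && _); rewrite ?normr1 ?normr0.
apply: lt_le_trans r20 _.
have := @coord_sub_le_ediam _ _ _ i bW Wy Wx.
by rewrite !mxE !eqxx mulr1 addrAC subrr add0r.
Qed.

Lemma compact_closure_bounded W : bounded_set W -> compact (closure W).
Proof.
move=> /ex_strict_bound_gt0[B B0 WB].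
apply: bounded_closed_compact; last exact: closed_closure.
exists (B + 1); split; first exact: num_real.
move=> M BM x /(_ _ (nbhsx_ballx x 1 ltr01))[y [/WB/= yB]].
rewrite -ball_normE /= => xy.
rewrite (le_trans _ (ltW BM))//.
by rewrite -(subrK y x) (le_trans (ler_normD _ _))// addrC lerD// ltW.
Qed.

(** A closed half-space containing W contains its closure. The touching point is first found in the
    closure, where this bound is applied. *)
Lemma coord_sub_le_ediam_closure W x y i :
  bounded_set W -> W x -> closure W y -> x 0 i - y 0 i <= ediam W.
Proof.
move=> bW Wx cWy.
have : closed [set z : 'rV[R]_n | x 0 i - ediam W <= z 0 i].
  apply: (@preimage_closed _ _ (fun z : 'rV[R]_n => z 0 i) [set r | x 0 i - ediam W <= r]).
    by move=> z _; exact: coord_continuous.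
  exact: closed_ge.
move=> /(_ y) H; rewrite lerBlDr -lerBlDl; apply: H.
apply: closure_subset cWy => z Wz /=.
by rewrite lerBlDl -lerBlDr coord_sub_le_ediam.
Qed.

End geometry.

(** * Suprema over level sets *)

Section level_sup.
Variables (R : realType) (n : nat).
Variables (W : set 'rV[R]_n) (f u : 'rV[R]_n -> R) (a M : R).

Let G r := sup_norm [set x | W x /\ u^\+%R x = r]
  (f^\+ \* \1_(upper_contact W u))%R.

Lemma sup_norm_ge0 (A : set 'rV[R]_n) (g : 'rV[R]_n -> R) : (0 <= sup_norm A g)%E.
Proof. by apply: ereal_sup_ubound; left. Qed.

Lemma sup_norm_ge (A : set 'rV[R]_n) (g : 'rV[R]_n -> R) x :
  A x -> (`|g x|%:E <= sup_norm A g)%E.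
Proof. by move=> Ax; apply: ereal_sup_ubound; right; exists x. Qed.

Lemma sup_norm_le (A : set 'rV[R]_n) (g : 'rV[R]_n -> R) c :
  0 <= c -> (forall x, A x -> `|g x| <= c) -> (sup_norm A g <= c%:E)%E.
Proof.
move=> c0 gc; apply: ge_ereal_sup => _ [->|[x Ax <-]]; rewrite lee_fin//.
exact: gc.
Qed.

(** The contact points with u >= a and f >= b' form a compact set, so its image under u is closed. A
    level r with g r < b' is outside this image, hence so are nearby levels, where g <= b'. Since a
    > 0, levels of u^+ above a are levels of u. *)
Lemma usc_level_sup :
  open W -> bounded_set W -> {in W, continuous f} ->
  {within closure W, continuous u} -> 0 < a ->
  (forall x, closure W x -> u x <= M) ->
  (forall x, closure W x -> a <= u x -> W x) ->
  exists (g : R -> R) (c : R),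
  [/\ forall r, a <= r <= M -> G r = (g r)%:E,
      forall r, a <= r <= M -> 0 <= g r <= c
    & forall r b, a <= r <= M -> g r < b ->
        \forall s \near r, a <= s <= M -> g s < b].
Proof.
move=> oW bW cf cu a0 uM aW.
have subW : W `<=` closure W by exact: subset_closure.
have cW := compact_closure_bounded _ _ _ bW.
have cuW : {in W, continuous u}.
  by rewrite -continuous_open_subspace//; exact: continuous_subspaceW subW cu.
have upos x r : a <= r -> u^\+ x = r -> u x = r.
  rewrite /funrpos => ar; have [_ <-//|u0 r0] := leP 0 (u x).
  by move: ar; rewrite -r0 leNgt a0.
pose Ca := [set x | closure W x /\ a <= u x].
have clCa : closed Ca by apply: closed_ge_within => //; exact: closed_closure.
have cCa : compact Ca by apply: subclosed_compact clCa cW _ => x [].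
have CaW : Ca `<=` W by move=> x [/aW]; exact.
(* f may blow up at the boundary of W, but [Ca] is a compact subset of W. *)
have [c0 [c00 fc]] : exists c, 0 <= c /\ forall x, Ca x -> f x <= c.
  have [[x Cax]|Ca0] := pselect (Ca !=set0).
    have fwi : {within Ca, continuous f}.
      apply: continuous_in_subspaceT => z; rewrite inE => /CaW Wz.
      by apply: cf; rewrite inE.
    have [z _ zP] := compact_EVT_max (ex_intro _ x Cax) cCa fwi.
    exists (Num.max 0 (f z)); rewrite le_max lexx; split=> // y Cay.
    by rewrite le_max zP ?orbT// inE.
  by exists 0; split=> // x Cax; exfalso; apply: Ca0; exists x.
have Gc r : a <= r <= M -> (0 <= G r <= c0%:E)%E.
  move=> /andP[ar rM]; rewrite sup_norm_ge0/=; apply: sup_norm_le => // x.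
  move=> [Wx] /(upos _ _ ar) uxr.
  have fx : f x <= c0 by apply: fc; split; [exact: subW|rewrite uxr].
  rewrite normrM ger0_norm; last exact: funrpos_ge0.
  rewrite ger0_norm; last by rewrite indicE.
  rewrite indicE; case: (_ \in _); rewrite ?mulr0 ?mulr1//.
  by rewrite /funrpos ge_max fx c00.
have Gfin r : a <= r <= M -> G r = (fine (G r))%:E.
  move=> /Gc /andP[G0 Gc0]; rewrite fineK//.
  by rewrite ge0_fin_numE// (le_lt_trans Gc0)// ltry.
exists (fun r => fine (G r)), c0; split=> //.
  by move=> r rM; rewrite -!lee_fin -Gfin//; exact: Gc.
move=> r b rM gb.
(* Avoiding f >= b' yields only g s <= b', so b' is taken strictly below b. *)
pose b' := (fine (G r) + b) / 2.
have g0 : 0 <= fine (G r) by rewrite -lee_fin -Gfin//; have /andP[] := Gc r rM.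
have b'0 : 0 < b' by rewrite /b'; lra.
pose A := [set x | [/\ Ca x, upper_contact W u x & b' <= f x]].
have clA : closed A.
  move=> x xA.
  have Cax : Ca x by apply: clCa => U /xA [y [[Cay _ _] Uy]]; exists y.
  have Wx := CaW _ Cax.
  split => //.
    apply: (@upper_contact_closed _ _ _ _ _ M) => //.
      by move=> y Wy; apply: uM; exact: subW.
    by move=> U /xA [y [[_ cy _] Uy]]; exists y.
  rewrite leNgt; apply/negP => fb.
  have cfx : {for x, continuous f} by apply: cf; rewrite inE.
  have N : nbhs x [set y | f y < b'] by exact: (cvgr_lt _ cfx _ fb).
  by have [y [[_ _ fy] /=]] := xA _ N; rewrite ltNge fy.
have cA : compact A by apply: subclosed_compact clA cCa _ => x [].
have cluA : closed (u @` A).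
  apply: compact_closed; first exact: Rhausdorff.
  apply: continuous_compact cA; apply: continuous_subspaceW cu => x [] [].
  by [].
have nr : ~ (u @` A) r.
  move=> [x [[_ arx] ctx fx] uxr].
  have [Wx _] := ctx.
  have := @sup_norm_ge [set x | W x /\ u^\+%R x = r] (f^\+ \* \1_(upper_contact W u))%R x.
  rewrite -/(G r) Gfin// lee_fin => /(_ _) H.
  have ur : u^\+ x = r.
    by rewrite /funrpos uxr; apply/max_idPl; rewrite -uxr (le_trans _ arx)// ltW.
  have := H (conj Wx ur).
  rewrite /= indicE mem_set// mulr1 => /(le_trans (ler_norm _)).
  have : f x <= f^\+ x by rewrite /funrpos le_max lexx.
  by rewrite /b' in fx; lra.
have : nbhs r (~` (u @` A)).
  by apply: open_nbhs_nbhs; split => //; exact: closed_openC.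
apply: filterS => s /= sA sM.
apply: (@le_lt_trans _ _ b'); last by rewrite /b'; lra.
rewrite -lee_fin -Gfin//; apply: sup_norm_le; first exact: ltW.
have /andP[as_ _] := sM.
move=> x [Wx] /(upos _ _ as_) uxs.
rewrite normrM ger0_norm; last exact: funrpos_ge0.
rewrite ger0_norm; last by rewrite indicE.
rewrite indicE; case: (boolP (x \in _)) => [|_]; last by rewrite mulr0 ltW.
rewrite inE mulr1 => ctx.
rewrite /funrpos ge_max (ltW b'0) andbT leNgt; apply/negP => fb.
apply: sA; exists x => //; split=> //; last exact: ltW.
by split; [exact: subW|rewrite uxs].
Qed.

End level_sup.

(** * Sliding the barrier *)

(* Both viscosity inequalities are only used on these quadratics, which makes
   part (ii) an instance of part (i) for - u and - f. *)
Definition planar_touching_le (R : realType) (n : nat) (p : R) (W : set 'rV[R]_n)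
    (u f : 'rV[R]_n -> R) (i : 'I_n) : Prop :=
  forall (x : 'rV[R]_n) (b c : R), W x -> 0 < b ->
    local_max_on W (u \- (fun y : 'rV[R]_n =>
      b * (y 0 i - x 0 i) - c / 2 * (y 0 i - x 0 i) ^+ 2)) x ->
    (p - 1) / p * c <= f x.

(** As [T] inverts the barrier, maximizing T (u x) - x_i over the closure selects the translate that
    first touches u from above. Concavity of the barrier makes the maximizer a contact point, and
    parabolas above the barrier serve as test functions. *)
Lemma sliding_touching (R : realType) (n : nat) (W : set 'rV[R]_n) (p a M : R)
    (f u : 'rV[R]_n -> R) (h : R -> R) (i : 'I_n) :
  open W -> bounded_set W ->
  {within closure W, continuous u} -> planar_touching_le R n p W u f i ->
  a < M -> (forall x, closure W x -> u x <= M) ->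
  (forall x, closure W x -> a < u x -> W x) -> (exists2 x, W x & u x = M) ->
  continuous h -> (forall r, 0 <= h r) ->
  ((2 * ediam W ^+ 2)%:E * \int[lebesgue_measure]_(r in `[a, M]) (h r)%:E <
   ((M - a) ^+ 2)%:E)%E ->
  exists x, [/\ W x, a < u x, upper_contact W u x &
    forall c, c < h (u x) -> (p - 1) / p * c <= f x].
Proof.
move=> oW bW cu touch aM uM aW [x0 Wx0 ux0] ch h0 hint.
have subW : W `<=` closure W by exact: subset_closure.
have cW := compact_closure_bounded _ _ _ bW.
have cW0 : closure W !=set0 by exists x0; exact: subW.
have [z0 _ uz0] := compact_EVT_min cW0 cW cu.
(* All values of u, and a itself, must lie in the range (A, M + 1) where [T] is increasing. *)
pose A := Num.min (u z0) a - 1.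
have Au x : closure W x -> A < u x.
  move=> Wx; rewrite /A ltrBlDr (@le_lt_trans _ _ (u x)) ?ltrDl//.
  by rewrite ge_min uz0// inE.
have Aa : A < a by rewrite /A ltrBlDr (@le_lt_trans _ _ a) ?ltrDl// ge_min lexx orbT.
have MB : M < M + 1 by rewrite ltrDl.
have d0 := ediam_gt0 _ _ _ _ i oW bW Wx0.
have [T [F [cT Tmono TMa TF Tloc]]] := barrier _ _ _ _ _ _ _ ch h0 Aa aM MB d0 hint.
have ui x : closure W x -> A < u x < M + 1.
  by move=> cx; rewrite Au//= (le_lt_trans (uM _ cx)).
have Tle v w : A < v < M + 1 -> A < w < M + 1 -> v <= w -> T v <= T w.
  move=> vi wi; rewrite le_eqVlt => /predU1P[->//|vw].
  by apply/ltW/Tmono.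
have cg : {within closure W, continuous (fun x : 'rV[R]_n => T (u x) - x 0 i)}.
  rewrite continuous_subspace_in => x; rewrite inE => cx.
  apply: cvgB; last first.
    exact: (continuous_subspaceT (@coord_continuous _ _ _ 0 i)).
  apply: (@continuous_comp _ _ _ (u : subspace (closure W) -> R) T); first exact: cu.
  by have [] := cT _ (ui _ cx).
have [x1 + x1max] : exists2 x1 : 'rV[R]_n, x1 \in closure W &
    forall y : 'rV[R]_n, y \in closure W ->
      T (u y) - y 0 i <= T (u x1) - x1 0 i := compact_EVT_max cW0 cW cg.
rewrite inE => cx1.
(* Otherwise comparison with x0, where u = M, gives T M - T a <= x0_i - x1_i <= d. *)
have au1 : a < u x1.
  rewrite ltNge; apply/negP => u1a.
  have := x1max x0 (mem_set (subW _ Wx0)); rewrite ux0.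
  have := Tle _ a (ui _ cx1); rewrite Aa (lt_trans aM MB) => /(_ isT u1a).
  have := coord_sub_le_ediam_closure _ _ _ _ _ i bW Wx0 cx1.
  lra.
have Wx1 := aW _ cx1 au1.
have Tx1 y : closure W y -> T (u y) <= T (u x1) + (y 0 i - x1 0 i).
  by move=> cy; have := x1max y (mem_set cy); lra.
have F0 : 0 < F (u x1) by have [] := cT _ (ui _ cx1).
exists x1; split => //.
  apply: (@upper_contact_support _ _ _ _ _ (F (u x1)) i) => //.
    move=> y /subW cy; rewrite -lerBlDl.
    apply: le_trans (TF _ _ (ui _ cx1) (ui _ cy)) _.
    by rewrite ler_pM2l// lerBlDl; exact: Tx1.
  by exists M => y /subW; exact: uM.
move=> c cvh; apply: (touch x1 (F (u x1)) c Wx1 F0).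
have vi : A < u x1 <= M by rewrite Au// uM.
have N := Tloc _ _ vi cvh.
have ct : {for x1, continuous (fun y : 'rV[R]_n => y 0 i - x1 0 i)}.
  apply: (@continuousB _ _ _ (fun y : 'rV[R]_n => y 0 i) (cst (x1 0 i))).
    exact: coord_continuous.
  exact: cst_continuous.
pose P t := A < u x1 + F (u x1) * t - c / 2 * t ^+ 2 /\
  T (u x1) + t <= T (u x1 + F (u x1) * t - c / 2 * t ^+ 2).
have {}N : \forall y \near x1, P ((y : 'rV[R]_n) 0 i - x1 0 i).
  by move: ct; rewrite /prop_for /continuous_at subrr; apply.
apply: filterS N => y /= [Ay Ty] Wy.
rewrite subrr mulr0 expr0n/= mulr0 subr0 subr0 lerBlDr addrA.
(* If u exceeded the parabola at y, monotonicity of [T] would contradict the maximality of x1. *)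
rewrite leNgt; apply/negP => uy.
have cy := subW _ Wy.
have /andP[Auy uyB] := ui _ cy.
have : T (u x1 + F (u x1) * (y 0 i - x1 0 i) - c / 2 * (y 0 i - x1 0 i) ^+ 2) < T (u y).
  by apply: Tmono => //; rewrite ?Ay ?Auy ?uyB// (lt_trans uy).
by rewrite ltNge (le_trans (Tx1 _ cy)).
Qed.

Lemma level_estimate (R : realType) (n : nat) (W : set 'rV[R]_n) (p m M : R)
    (f u : 'rV[R]_n -> R) (i : 'I_n) :
  open W -> bounded_set W -> 1 < p -> {in W, continuous f} ->
  {within closure W, continuous u} -> planar_touching_le R n p W u f i ->
  0 <= m -> m < M -> (forall x, closure W x -> u x <= M) ->
  (forall x, closure W x -> m < u x -> W x) -> (exists2 x, W x & u x = M) ->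
  (((M - m) ^+ 2)%:E <= (2 * p * ediam W ^+ 2 / (p - 1))%:E *
      \int[lebesgue_measure]_(r in `[m, M])
        sup_norm [set x | W x /\ u^\+%R x = r]
          (f^\+ \* \1_(upper_contact W u))%R)%E.
Proof.
move=> oW bW p1 cf cu touch m0 mM uM mW xM.
have d0 : 0 < ediam W by have [x Wx _] := xM; exact: ediam_gt0 i oW bW Wx.
set G := fun r => sup_norm _ _.
set I := (\int[_]_(r in _) _)%E.
have I0 : (0 <= I)%E by apply: integral_ge0 => r _; exact: sup_norm_ge0.
have p0 : 0 < p - 1 by rewrite subr_gt0.
have pp : 0 < p by rewrite (lt_trans _ p1).
set K := 2 * p * ediam W ^+ 2 / (p - 1).
have K0 : 0 < K by rewrite divr_gt0// mulr_gt0 ?exprn_gt0// mulr_gt0.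
rewrite leNgt; apply/negP => lt.
(* As K > 0, an infinite integral would make the right-hand side infinite. *)
have Ifin : I \is a fin_num.
  rewrite ge0_fin_numE// ltey; apply/eqP => Ioo.
  by move: lt; rewrite Ioo gt0_muley ?lte_fin.
move: lt; rewrite -(fineK Ifin) -EFinM lte_fin => lt.
have Ir0 : 0 <= fine I by exact: fine_ge0.
set Ir := fine I in lt Ir0.
pose q := Num.sqrt (K * Ir).
have q0 : 0 <= q by exact: sqrtr_ge0.
have KI0 : 0 <= K * Ir by rewrite mulr_ge0// ltW.
have qM : q < M - m.
  rewrite -(@ltr_pXn2r _ 2)// ?nnegrE ?subr_ge0 ?(ltW mM)//.
  by rewrite /q sqr_sqrtr.
(* M - a is the midpoint of q and M - m, so a > m while (M - a)^2 > K I still holds. *)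
pose a := M - (q + (M - m)) / 2.
have ma : m < a by rewrite /a; lra.
have aM : a < M by rewrite /a; lra.
have lta : K * Ir < (M - a) ^+ 2.
  rewrite -[ltLHS]sqr_sqrtr// -/q ltr_pXn2r// ?nnegrE ?subr_ge0 ?(ltW aM)//.
  by rewrite /a; lra.
have a0 : 0 < a by exact: le_lt_trans ma.
have aW x : closure W x -> a <= u x -> W x.
  by move=> cx ax; apply: mW => //; exact: lt_le_trans ax.
have [g [c [Gg gc gusc]]] := usc_level_sup _ _ _ _ _ _ _ oW bW cf cu a0 uM aW.
(* The error K e uses half of the gap (M - a)^2 - K I. *)
pose e := ((M - a) ^+ 2 - K * Ir) / (2 * K).
have e0 : 0 < e by rewrite divr_gt0 ?subr_gt0// mulr_gt0.
have [h [ch h0 gh hI]] := usc_continuous_majorant _ _ _ _ _ _ aM gc gusc e0.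
pose k := p / (p - 1).
have k0 : 0 < k by rewrite divr_gt0.
have mh : measurable_fun `[a, M] (EFin \o h).
  apply/measurable_EFinP.
  by apply: measurable_funS (continuous_measurable_fun ch).
have gI : (\int[lebesgue_measure]_(r in `[a, M]) (g r)%:E <= I)%E.
  apply: ge0_le_integral_nonmeasurable.
  - move=> r /=; rewrite !in_itv/= => /andP[ar ->]; rewrite andbT.
    by rewrite (le_trans _ ar)// ltW.
  - by move=> r /=; rewrite in_itv/= => /gc/andP[].
  - by move=> r _; exact: sup_norm_ge0.
  - by move=> r /=; rewrite in_itv/= => rM; rewrite -Gg.
have hint : ((2 * ediam W ^+ 2)%:E *
    \int[lebesgue_measure]_(r in `[a, M]) (k * h r)%:E < ((M - a) ^+ 2)%:E)%E.
  under eq_integral do rewrite EFinM.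
  rewrite ge0_integralZl_EFin//; [|by move=> r _; rewrite lee_fin|exact: ltW].
  rewrite muleA -EFinM (_ : _ * k = K); last by rewrite /K /k; ring.
  apply: (@le_lt_trans _ _ (K%:E * (Ir + e)%:E)%E).
    rewrite lee_pmul2l ?lte_fin//.
    apply: (le_trans hI); rewrite EFinD leeD2r//.
    by rewrite (le_trans gI)// /Ir fineK.
  rewrite -EFinM lte_fin mulrDr /e.
  rewrite (_ : K * (_ / _) = ((M - a) ^+ 2 - K * Ir) / 2); last first.
    by field; rewrite gt_eqF.
  by move: lta; set X := (M - a) ^+ 2; lra.
have ckh : continuous (fun r => k * h r).
  by move=> r; apply: cvgM; [exact: cvg_cst|exact: ch].
have kh0 r : 0 <= k * h r by rewrite mulr_ge0// ltW.
have [|x [Wx ax ctx fx]] := sliding_touching _ _ _ _ _ _ _ _ _ _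
  oW bW cu touch aM uM _ xM ckh kh0 hint.
  by move=> x cx /ltW; exact: aW.
have cx : closure W x by exact: subset_closure.
have uxM : a <= u x <= M by rewrite ltW//= uM.
have := gh _ uxM; rewrite -(ltr_pM2l k0) => kgh.
(* The curvature must be strictly below k h; the midpoint of k g and k h still forces f x > g (u
   x). *)
have := fx (k * (g (u x) + h (u x)) / 2).
rewrite -/k => H.
have {}H : (g (u x) + h (u x)) / 2 <= f x.
  apply: le_trans (H _); last by lra.
  by rewrite le_eqVlt; apply/orP; left; apply/eqP; rewrite /k; field; rewrite !gt_eqF.
have uxp : u^\+ x = u x.
  by rewrite /funrpos; apply/max_idPl; rewrite (le_trans _ (ltW ax))// ltW.
have fg : f x <= g (u x).
  rewrite -lee_fin -Gg//.
  apply: le_trans (sup_norm_ge _ _ _ _ x _); last by [].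
  rewrite lee_fin /= indicE mem_set// mulr1.
  by rewrite (le_trans _ (ler_norm _))// /funrpos le_max lexx.
by have := gh _ uxM; lra.
Qed.

(** * Planar quadratics in the viscosity inequalities *)

Section planar_test_functions.
Variables (R : realType) (n : nat) (p : R) (W : set 'rV[R]_n).
Variables (i : 'I_n) (x : 'rV[R]_n).

Let q (b c s : R) := b * (s - x 0 i) - c / 2 * (s - x 0 i) ^+ 2.

Let dq b c (s : R) : is_derive s 1 (q b c) (b - c * (s - x 0 i)).
Proof.
rewrite (_ : q b c = b \*: (id - cst (x 0 i)) -
    (c / 2) \*: ((id - cst (x 0 i)) ^+ 2));
  last by apply/funext => r; rewrite /q !fctE.
apply: is_derive_eq; rewrite !fctE /GRing.scale/= expr1; field => //.
Qed.

Let ddq b c (s : R) : is_derive s 1 (fun s => b - c * (s - x 0 i)) (- c).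
Proof.
rewrite (_ : (fun s => _) = (cst b - c \*: (id - cst (x 0 i))));
  last by apply/funext => r; rewrite !fctE.
by apply: is_derive_eq; rewrite /GRing.scale/= subr0 mulr1 sub0r.
Qed.

Let phi b c := fun y : 'rV[R]_n => q b c (y 0 i).

Lemma C2_on_planar b c : C2_on W (phi b c).
Proof.
apply: (@C2_on_coord _ _ _ (q b c) _ (cst (- c)) i (dq b c) (ddq b c)).
exact: cst_continuous.
Qed.

Lemma grad_planar_neq0 b c : b != 0 -> grad (phi b c) x != 0.
Proof.
move=> b0; rewrite (grad_coord _ _ _ _ _ _ (dq b c)) subrr mulr0 subr0.
apply/eqP => /rowP /(_ i); rewrite !mxE !eqxx mulr1.
exact/eqP.
Qed.

Lemma plaplN_planar b c : b != 0 -> plaplN p (phi b c) x = - ((p - 1) / p * c).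
Proof.
move=> b0; rewrite (@plaplN_coord _ _ _ (q b c) _ _ i x (dq b c) (ddq b c)) ?mulrN//.
by rewrite subrr mulr0 subr0.
Qed.

End planar_test_functions.

Lemma visc_le_planar_touching (R : realType) (n : nat) (p : R) (W : set 'rV[R]_n)
    (u f : 'rV[R]_n -> R) (i : 'I_n) :
  visc_plaplN_le p W u f -> planar_touching_le R n p W u f i.
Proof.
move=> [_ visc] x b c Wx b0 lmax.
have [+ _ _] := visc x _ Wx (C2_on_planar _ _ _ _ x b c) lmax.
by rewrite plaplN_planar ?gt_eqF// opprK; apply; rewrite grad_planar_neq0 ?gt_eqF.
Qed.

(** A quadratic touching - u from above is, after negation, one with coefficients - b and - c
    touching u from below. *)
Lemma visc_ge_planar_touching (R : realType) (n : nat) (p : R) (W : set 'rV[R]_n)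
    (u f : 'rV[R]_n -> R) (i : 'I_n) :
  visc_plaplN_ge p W u f -> planar_touching_le R n p W (\- u) (\- f) i.
Proof.
move=> [_ visc] x b c Wx b0 lmax.
have lmin : local_min_on W (u \- (fun y : 'rV[R]_n =>
    - b * (y 0 i - x 0 i) - - c / 2 * (y 0 i - x 0 i) ^+ 2)) x.
  by apply: filterS lmax => y /[apply] /=; lra.
have [+ _ _] := visc x _ Wx (C2_on_planar _ _ _ _ x (- b) (- c)) lmin.
rewrite plaplN_planar ?oppr_eq0 ?gt_eqF// opprK mulrN lerNr.
by apply; rewrite grad_planar_neq0 ?oppr_eq0 ?gt_eqF.
Qed.

(** When the two suprema differ, the maximum of u over the closure is positive, equals the supremum
    of u^+ and is attained inside W; otherwise the left-hand side is zero. *)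
Lemma abp_estimate (R : realType) (n : nat) (W : set 'rV[R]_n) (p : R)
    (f u : 'rV[R]_n -> R) (i : 'I_n) :
  open W -> bounded_set W -> 1 < p ->
  {within W, continuous f} -> {within closure W, continuous u} ->
  planar_touching_le R n p W u f i ->
  (((sup (u^\+ @` W) - sup (u^\+ @` boundary W)) ^+ 2)%:E <=
      (2 * p * ediam W ^+ 2 / (p - 1))%:E *
      \int[lebesgue_measure]_(r in
          `[sup (u^\+ @` boundary W)%R, sup (u^\+ @` W)%R])
        sup_norm [set x | W x /\ u^\+%R x = r]
          (f^\+ \* \1_(upper_contact W u))%R)%E.
Proof.
move=> oW bW p1 cf cu touch.
set m := sup (u^\+ @` boundary W); set M := sup (u^\+ @` W).
have rhs0 : m = M -> (((M - m) ^+ 2)%:E <=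
      (2 * p * ediam W ^+ 2 / (p - 1))%:E *
      \int[lebesgue_measure]_(r in `[m, M])
        sup_norm [set x | W x /\ u^\+%R x = r]
          (f^\+ \* \1_(upper_contact W u))%R)%E.
  move=> ->; rewrite subrr expr0n/= mule_ge0//.
    rewrite lee_fin divr_ge0 ?subr_ge0 ?(ltW p1)// mulr_ge0 ?sqr_ge0//.
    by rewrite mulr_ge0// (le_trans _ (ltW p1)).
  by apply: integral_ge0 => r _; exact: sup_norm_ge0.
have [W0|/set0P[x0 Wx0]] := eqVneq W set0.
  by apply: rhs0; rewrite /m /M /boundary W0 closure0 set0D !image_set0.
have subW : W `<=` closure W by exact: subset_closure.
have cW := compact_closure_bounded _ _ _ bW.
have bdryE : boundary W = closure W `\` W.
  by rewrite /boundary (interior_id W).1.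
have [z + zmax] : exists2 z : 'rV[R]_n, z \in closure W &
    forall y : 'rV[R]_n, y \in closure W -> u y <= u z.
  by apply: compact_EVT_max => //; exists x0; exact: subW.
rewrite inE => cz.
have {}zmax y : closure W y -> u y <= u z by move=> cy; apply: zmax; rewrite inE.
have pmax y : closure W y -> u^\+ y <= u^\+ z.
  by move=> /zmax yz; rewrite /funrpos ge_max !le_max yz lexx orbT.
have leM y : W y -> u^\+ y <= M.
  by move=> Wy; apply: ub_le_sup; [exists (u^\+ z) => _ [t /subW/pmax ? <-]|exists y].
have M0 : 0 <= M by apply: le_trans (leM _ Wx0); exact: funrpos_ge0.
have Mz : M = u^\+ z.
  (* The maximizer z may lie on the boundary a priori; points of W near z show that the supremum
     over W is not smaller. *)
  apply/eqP; rewrite eq_le; apply/andP; split.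
    by apply: ge_sup; [exists (u^\+ x0), x0|move=> _ [t /subW/pmax ? <-]].
  rewrite /funrpos ge_max M0 andbT leNgt; apply/negP => Mu.
  have N := within_continuous_near _ _ _ _ _ _ cu cz (lt_nbhsr Mu).
  have [y [Wy /(_ (subW _ Wy)) /=]] := cz _ N.
  by rewrite ltNge (le_trans _ (leM _ Wy))// /funrpos le_max lexx.
have lem y : closure W y -> ~ W y -> u^\+ y <= m.
  move=> cy nWy; apply: ub_le_sup; last by exists y => //; rewrite bdryE.
  by exists (u^\+ z) => _ [t [/pmax ? _] <-].
have [m0 mM] : 0 <= m /\ m <= M.
  (* For an empty boundary, m is the default value 0 of [sup]. *)
  have [B0|/set0P[y0 By0]] := eqVneq (boundary W) set0.
    by rewrite /m B0 image_set0 sup0.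
  split.
    move: By0; rewrite bdryE => -[cy0 nWy0].
    by apply: le_trans (lem y0 cy0 nWy0); exact: funrpos_ge0.
  by rewrite Mz; apply: ge_sup; [exists (u^\+ y0), y0|move=> _ [t [/pmax ? _] <-]].
move: mM; rewrite le_eqVlt => /predU1P[/rhs0//|mM].
have uz : u z = M.
  rewrite Mz /funrpos; apply/esym/max_idPl; rewrite leNgt; apply/negP => uz0.
  by have := le_lt_trans m0 mM; rewrite Mz /funrpos (max_idPr (ltW uz0)) ltxx.
have mW y : closure W y -> m < u y -> W y.
  move=> cy my; have [//|nWy] := pselect (W y).
  have := lem _ cy nWy; rewrite leNgt => /negP[].
  by rewrite (lt_le_trans my)// /funrpos le_max lexx.
apply: (@level_estimate _ _ _ _ _ _ _ _ i) => //.
- by rewrite -continuous_open_subspace.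
- by move=> y /zmax; rewrite uz.
- by exists z => //; apply: mW; rewrite ?uz.
Qed.

Theorem theorem4p1 (R : realType) (n : nat) (W : set 'rV[R]_n) (p : R)
    (f u : 'rV[R]_n -> R) :
  (2 <= n)%N -> open W -> bounded_set W -> 1 < p ->
  {within W, continuous f} -> {within closure W, continuous u} ->
  (visc_plaplN_le p W u f ->
     (((sup (u^\+ @` W) - sup (u^\+ @` boundary W)) ^+ 2)%:E <=
      (2 * p * ediam W ^+ 2 / (p - 1))%:E *
      \int[lebesgue_measure]_(r in
          `[sup (u^\+ @` boundary W)%R, sup (u^\+ @` W)%R])
        sup_norm [set x | W x /\ u^\+%R x = r]
          (f^\+ \* \1_(upper_contact W u))%R)%E) /\
  (visc_plaplN_ge p W u f ->
     (((sup (u^\- @` W) - sup (u^\- @` boundary W)) ^+ 2)%:E <=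
      (2 * p * ediam W ^+ 2 / (p - 1))%:E *
      \int[lebesgue_measure]_(r in
          `[sup (u^\- @` boundary W)%R, sup (u^\- @` W)%R])
        sup_norm [set x | W x /\ u^\-%R x = r]
          (f^\- \* \1_(upper_contact W (\- u)))%R)%E).
Proof.
(* With n = 0 excluded by 2 <= n, the first axis [ord0] serves as the sliding direction. *)
case: n W f u => // n W f u _ oW bW p1 cf cu.
split=> [/visc_le_planar_touching|/visc_ge_planar_touching] touch.
  by apply: (abp_estimate _ _ _ _ _ _ ord0) => //; exact: touch.
rewrite -!funrposN.
apply: (abp_estimate _ _ _ _ (\- f) (\- u) ord0) => //.
- by move=> x; apply: cvgN; exact: cf.
- by move=> x; apply: cvgN; exact: cu.
Qed.
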